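(* Let $n\ge 1$ and let $f\in\mathbb{Q}\langle\langle x,z\rangle\rangle$ be admissible. Then the map $\chi_f:\mathrm{Sei}(n)\to\hat\Lambda$ descends to a map $$\mathrm{Sei}(n)/(S_{12})\to\hat\Lambda ,$$ i.e. $\chi_f(A)=\chi_f(B)$ whenever $A,B\in\mathrm{Sei}(n)$ are equivalent under the equivalence relation generated by the moves $S_1$ and $S_2$.
   Context: Let $F$ be the free group on $t_1,\dots,t_n$, $\Lambda=\mathbb{Q}[F]$, and $\hat\Lambda$ the completion of $\Lambda$ with respect to powers of the augmentation ideal, identified with the ring $\mathbb{Q}\langle\langle x_1,\dots,x_n\rangle\rangle$ of power series in the noncommuting variables $x_i=t_i-1$. $M'$ denotes the transpose of a matrix $M$. Seifert matrices. $\mathrm{Sei}(n)$ is the set of square integer matrices $A=(A_{ij})_{1\le i,j\le n}$ partitioned into $n\times n$ blocks (with square diagonal blocks, of arbitrary sizes) such that $A_{ij}'=A_{ji}$ for $i\neq j$ and $\det(A_{ii}-A_{ii}')=1$ for all $i$. Thus $A-A'$ is block diagonal and invertible over $\mathbb{Z}$, and each diagonal block has even size. Put $Z_A=A(A-A')^{-1}$. Moves. $S_1$: replace $A$ by $PAP'$, where $P=\mathrm{diag}(P_1,\dots,P_n)$ is block diagonal (with the same block sizes as $A$) with each $P_i$ a unimodular integer matrix. $S_2$: replace $A$ by $$\begin{pmatrix}A&\rho&0\\ \rho'&0&1\\ 0&0&0\end{pmatrix}\quad\text{or}\quad \begin{pmatrix}A&\rho&0\\ \rho'&0&0\\ 0&1&0\end{pmatrix}$$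 for an integer column vector $\rho$, where for some $i$ the two new rows are added to the blocks $A_{ij}$, $1\le j\le n$, and the two new columns are added to the blocks $A_{ji}$, $1\le j\le n$ (so the $i$-th diagonal block is enlarged by 2). Invariants. A noncommutative power series $f\in\mathbb{Q}\langle\langle x,z\rangle\rangle$ is admissible if for every non-negative integer $m$ it has only finitely many terms of total $x$-degree $m$. For $A\in\mathrm{Sei}(n)$ let $X=\mathrm{diag}(x_1,\dots,x_n)$ be the block diagonal matrix, with the same block sizes as $A$, whose $i$-th diagonal block is $x_i$ times the identity, and let $I_{1/2}$ be a diagonal matrix of the same size in which, in each diagonal block, half of the diagonal entries are $0$ and half are $1$. For admissible $f$, $$\chi_f(A)=\mathrm{tr}\big(f(X,Z_A)-f(X,I_{1/2})\big)\in\hat\Lambda$$ (this does not depend on how the $0$'s and $1$'s are distributed in $I_{1/2}$). *)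

(* Defs.v *)
From HB Require Import structures.
From Stdlib Require Import Relation_Operators.
From mathcomp Require Import all_boot all_order all_algebra.
From mathcomp Require Import boolp classical_sets functions cardinality fsbigop.

Set Implicit Arguments.
Unset Strict Implicit.
Unset Printing Implicit Defensive.
Import Order.TTheory GRing.Theory Num.Theory.
Local Open Scope ring_scope.

(* Power series in noncommuting variables indexed by I: the coefficient of the
   monomial v_1 ... v_k is the value at the word [:: v_1; ...; v_k]. *)
Definition ncseries (I : Type) (R : nzRingType) : Type := seq I -> R.

Section NCSeries.
Variables (I : Type) (R : nzRingType).

HB.instance Definition _ := GRing.Zmodule.copy (ncseries I R) (seq I -> R).

Definition ncone : ncseries I R := fun w => (nilp w)%:R.

Definition ncmul (f g : ncseries I R) : ncseries I R := fun w =>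
  \sum_(i < (size w).+1) f (take i w) * g (drop i w).

Let shift (x : I) (f : ncseries I R) : ncseries I R := fun w => f (x :: w).

Lemma ncmul_nil f g : ncmul f g [::] = f [::] * g [::].
Proof. by rewrite /ncmul big_ord1. Qed.

Lemma ncmul_cons f g x w :
  ncmul f g (x :: w) = f [::] * g (x :: w) + ncmul (shift x f) g w.
Proof. by rewrite /ncmul big_ord_recl. Qed.

Lemma ncmulDl : left_distributive ncmul +%R.
Proof.
move=> f g h; apply/funext => w.
have E (a b : ncseries I R) v : (a + b) v = a v + b v by [].
rewrite E /ncmul -big_split /=; apply: eq_bigr => i _.
by rewrite E mulrDl.
Qed.

Lemma ncmulDr : right_distributive ncmul +%R.
Proof.
move=> f g h; apply/funext => w.
have E (a b : ncseries I R) v : (a + b) v = a v + b v by [].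
rewrite E /ncmul -big_split /=; apply: eq_bigr => i _.
by rewrite E mulrDr.
Qed.

Lemma ncmulA : associative ncmul.
Proof.
move=> f g h; apply/funext => w; elim: w f g h => [|x w IH] f g h.
  by rewrite !ncmul_nil mulrA.
have sE : shift x (ncmul f g) =
    (fun v => f [::] * shift x g v) + ncmul (shift x f) g.
  by apply/funext => v; rewrite {1}/shift ncmul_cons.
rewrite ncmul_cons [RHS]ncmul_cons ncmul_nil sE ncmulDl IH ncmul_cons mulrDr.
rewrite -addrA -mulrA; congr (_ + _).
have E (a b : ncseries I R) v : (a + b) v = a v + b v by [].
rewrite E; congr (_ + _); rewrite /ncmul mulr_sumr.
by apply: eq_bigr => i _; rewrite mulrA.
Qed.

Lemma ncmul1 : left_id ncone ncmul.
Proof.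
move=> f; apply/funext => w; rewrite /ncmul big_ord_recl take0 drop0 mul1r.
rewrite big1 ?addr0 // => i _; rewrite /ncone.
by case: w i => [[]//|x w] i; rewrite mul0r.
Qed.

Lemma nc1mul : right_id ncone ncmul.
Proof.
move=> f; apply/funext => w; rewrite /ncmul big_ord_recr /= take_size drop_size.
rewrite mulr1 big1 ?add0r // => i _; rewrite /ncone.
by rewrite /nilp size_drop subn_eq0 leqNgt ltn_ord mulr0.
Qed.

Lemma ncone_neq0 : ncone != 0.
Proof.
apply/eqP => /(congr1 (fun f : ncseries I R => f [::])) /eqP.
by rewrite /ncone /= oner_eq0.
Qed.

HB.instance Definition _ := GRing.Zmodule_isNzRing.Build (ncseries I R)
  ncmulA ncmul1 nc1mul ncmulDl ncmulDr ncone_neq0.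

End NCSeries.

Definition ncvar (I : eqType) (R : nzRingType) (i : I) : ncseries I R :=
  fun w => (w == [:: i])%:R.

(* Q<<x, z>> is ncseries bool rat, where true stands for x and false for z. *)
Definition admissible (f : ncseries bool rat) : Prop :=
  forall m : nat,
    finite_set [set w : seq bool | count_mem true w = m /\ f w != 0]%classic.

Section Evaluation.
Variables (I : Type) (N : nat).
Implicit Types (X Z : 'M[ncseries I rat]_N).

Definition word_eval X Z (w : seq bool) : 'M[ncseries I rat]_N :=
  \prod_(b <- w) (if b then X else Z).

(* f(X, Z), summed coefficient by coefficient. The sum over all words is the
   finite-support sum of the library (0 by convention if the support is
   infinite). For f admissible, entries of X without constant term and Z
   constant, its support is finite: a word of x-degree m only contributes to
   monomials of degree at least m, and a monomial of degree m only receives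
   contributions from words of x-degree at most m. *)
Definition series_eval (f : ncseries bool rat) X Z : 'M[ncseries I rat]_N :=
  \matrix_(a, b) ((fun u : seq I =>
    \sum_(w \in [set: seq bool]%classic) f w * word_eval X Z w a b u)
      : ncseries I rat).

End Evaluation.

(* Integer matrices partitioned into n x n blocks, the (i, j) block having size
   p i x p j. *)
Definition is_seifert n (p : 'I_n -> nat) (A : 'M[int]_(\sum_i p i)) : Prop :=
  (forall i j, i != j -> (submxblock A i j)^T = submxblock A j i) /\
  (forall i, \det (submxblock A i i - (submxblock A i i)^T) = 1).

Record seifert (n : nat) := Seifert {
  sei_size : 'I_n -> nat;
  sei_mx : 'M[int]_(\sum_i sei_size i);
  seiP : is_seifert sei_mx }.
Arguments Seifert {n} sei_size sei_mx seiP.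

Section Moves.
Variables (n : nat) (p : 'I_n -> nat).
Implicit Types (A : 'M[int]_(\sum_i p i)) (i j k : 'I_n).

Definition move1_mx A (P : forall i, 'M[int]_(p i)) : 'M[int]_(\sum_i p i) :=
  (\mxdiag_i P i) *m A *m (\mxdiag_i P i)^T.

Definition extra i j : nat := (j == i).*2.

(* The two new rows (columns) are placed last among the rows (columns) of the
   i-th block. Blocks off row and column i are unchanged, since extra i j = 0
   for j != i. The flag c selects between the two forms of the lower right
   corner: (0 1; 0 0) if c is false, (0 0; 1 0) if c is true. *)
Definition move2_block A (rho : 'cV[int]_(\sum_i p i)) (c : bool) i j k
    : 'M[int]_(p j + extra i j, p k + extra i k) :=
  block_mx
    (submxblock A j k)
    (\matrix_(a, b) if val b == 0%N then submxcol rho j a 0 else 0)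
    (\matrix_(a, b) if val a == 0%N then submxcol rho k b 0 else 0)
    (\matrix_(a, b) if c then ((val a == 1%N) && (val b == 0%N))%:R
                    else ((val a == 0%N) && (val b == 1%N))%:R).

Definition move2_mx A rho c i : 'M[int]_(\sum_j (p j + extra i j)) :=
  \mxblock_(j, k) move2_block A rho c i j k.

Lemma move1_block A P i j :
  submxblock (move1_mx A P) i j = P i *m submxblock A i j *m (P j)^T.
Proof.
rewrite /move1_mx tr_mxdiag -{1}[A]submxblockK.
by rewrite mul_mxdiag_mxblock mul_mxblock_mxdiag mxblockK.
Qed.

Lemma move1_seifert A P : is_seifert A -> (forall i, P i \in unitmx) ->
  is_seifert (move1_mx A P).
Proof.
move=> [Asym Adet] Punit; split=> [i j ij|i]; rewrite !move1_block.
  by rewrite !trmx_mul trmxK Asym // mulmxA.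
rewrite !trmx_mul trmxK mulmxA -mulmxBl -mulmxBr !det_mulmx det_tr Adet mulr1.
by have := Punit i; rewrite unitmxE unfold_in => /orP[] /eqP ->.
Qed.

Lemma move2_seifert A rho c i : is_seifert A -> is_seifert (move2_mx A rho c i).
Proof.
move=> [Asym Adet]; split=> [j k jk|j]; rewrite !mxblockK /move2_block.
  rewrite tr_block_mx Asym //; congr block_mx; apply/matrixP => a b; rewrite !mxE //.
  have absurd (x : 'I_(extra i k)) (y : 'I_(extra i j)) : False.
    move: x y jk; rewrite /extra; case: (eqVneq k i) => [->|_] [x //= xP].
    by case: (eqVneq j i) => //= _ [].
  by case: (absurd a b).
rewrite tr_block_mx opp_block_mx add_block_mx.
set C := (X in block_mx _ X); have -> : C = 0.
  by apply/matrixP => a b; rewrite !mxE subrr.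
rewrite det_lblock Adet mul1r /extra; case: (j == i); last by rewrite det_mx00.
rewrite (expand_det_row _ ord0) !big_ord_recl big_ord0 /cofactor !det_mx11 !mxE.
by case: c.
Qed.

End Moves.

Inductive move12 (n : nat) : seifert n -> seifert n -> Prop :=
| Move1 p A (hA : is_seifert A) (P : forall i, 'M[int]_(p i))
    (hP : forall i, P i \in unitmx) :
    move12 (Seifert p A hA) (Seifert p (move1_mx A P) (move1_seifert hA hP))
| Move2 p A (hA : is_seifert A) (rho : 'cV[int]_(\sum_i p i)) c i :
    move12 (Seifert p A hA)
           (Seifert _ (move2_mx A rho c i) (move2_seifert rho c i hA)).

Definition s12_equiv (n : nat) : seifert n -> seifert n -> Prop :=
  clos_refl_sym_trans (seifert n) (@move12 n).

Section Invariant.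
Variables (n : nat) (f : ncseries bool rat) (A : seifert n).
Local Notation p := (sei_size A).
(* The completion of Q[F], F free on t_1, ..., t_n, at its augmentation ideal, with
   the i-th variable standing for t_i - 1. *)
Local Notation Lambda_hat := (ncseries 'I_n rat).

Definition seifert_Z : 'M[int]_(\sum_i p i) :=
  sei_mx A *m invmx (sei_mx A - (sei_mx A)^T).

Definition X_mx : 'M[Lambda_hat]_(\sum_i p i) :=
  \mxdiag_i (ncvar rat i)%:M.

(* The 0's and 1's alternate along each diagonal block. The block sizes p i are
   even, since the skew-symmetric A_ii - A_ii' is invertible. *)
Definition I_half : 'M[int]_(\sum_i p i) :=
  \mxdiag_i diag_mx (\row_(a < p i) (odd a)%:R).

Definition chi : Lambda_hat :=
  \tr (series_eval f X_mx (map_mx intr seifert_Z)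
       - series_eval f X_mx (map_mx intr I_half)).

End Invariant.

(* Main.v *)
Require Import Defs.
From mathcomp Require Import all_boot all_order all_algebra.
From mathcomp Require Import boolp classical_sets functions cardinality fsbigop.

Set Implicit Arguments.
Unset Strict Implicit.
Unset Printing Implicit Defensive.
Import Order.TTheory GRing.Theory Num.Theory.
Local Open Scope ring_scope.

(** The invariance holds word by word. For a word w in x and z, let chi_w(A) be
the trace of w(X, Z_A) minus the trace of w(X, I_half). The entries of X are
homogeneous of degree 1 and those of Z_A and I_half are constants, so w(X, Z)
is homogeneous of degree the number of x in w. By admissibility only finitely
many words of f reach a given coefficient of chi_f(A), which is therefore a
finite linear combination of coefficients of the chi_w(A), with weights that
do not depend on A (chi_word_chi). It remains to see that chi_w is unchanged
by each move.

A congruence by P = diag(P_i) replaces Z_A by P Z_A P^-1. As P commutes with X,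
w(X, Z_A) is conjugated by P as well. The coefficient ring is noncommutative,
but the entries of P are integers, hence central, and the trace is still
invariant under this conjugation (word_chi_move1).

For an enlargement A' of A, let a be the first and b the second new index.
The matrix A' - A'^T is the direct sum of A - A^T and of a skew 2 x 2 block, so
that Z_A' is computed from the equation Z_A' (A' - A'^T) = A'. In the order b,
old indices, a, it is block lower triangular, with diagonal blocks
e, Z_A, 1 - e where e is 0 or 1 according to the form of the move
(bordered_seifert_Z). In the same order X becomes diag(x_i, X, x_i) and I_half
becomes diag(e', I_half, 1 - e') with e' equal to 0 or 1. Triangular shapes
multiply, so both traces of w grow by w(x_i, 0) + w(x_i, 1), and the
difference is preserved (word_chi_move2). *)

(** * Reduction to words *)

Lemma ncseriesD_apply (I : Type) (R : nzRingType) (f g : ncseries I R) u :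
  (f + g) u = f u + g u.
Proof. by []. Qed.

Lemma ncseriesN_apply (I : Type) (R : nzRingType) (f : ncseries I R) u :
  (- f) u = - f u.
Proof. by []. Qed.

Lemma ncseries_sum_apply (I : Type) (R : nzRingType) (J : Type) (r : seq J)
    (P : pred J) (F : J -> ncseries I R) u :
  (\sum_(j <- r | P j) F j) u = \sum_(j <- r | P j) F j u.
Proof.
by elim/big_rec2: _ => // j y1 y2 _ <-; rewrite ncseriesD_apply.
Qed.

Definition homogeneous (I : Type) (R : nzRingType) d (g : ncseries I R) :=
  forall u, size u != d -> g u = 0.

Lemma homogeneousM (I : Type) (R : nzRingType) d e (g h : ncseries I R) :
  homogeneous d g -> homogeneous e h -> homogeneous (d + e) (g * h).
Proof.
move=> gd he u su; rewrite [LHS]big1 // => i _.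
have [id|id] := eqVneq (size (take i u)) d; last by rewrite gd // mul0r.
rewrite he ?mulr0 //; apply: contra su => /eqP ie.
by rewrite -(cat_take_drop i u) size_cat id ie.
Qed.

Lemma homogeneous_sum (I : Type) (R : nzRingType) d (J : Type) (r : seq J)
    (P : pred J) (F : J -> ncseries I R) :
  (forall j, homogeneous d (F j)) -> homogeneous d (\sum_(j <- r | P j) F j).
Proof. by move=> Fd u su; rewrite ncseries_sum_apply big1 // => j _; apply: Fd. Qed.

Lemma homogeneous_nat (I : Type) (R : nzRingType) k :
  homogeneous 0 (k%:R : ncseries I R).
Proof.
elim: k => [|k IH] u su //.
by rewrite mulrS ncseriesD_apply IH // addr0; case: u su.
Qed.

Lemma homogeneous_int (I : Type) (R : nzRingType) (m : int) :
  homogeneous 0 (m%:~R : ncseries I R).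
Proof.
case: m => k u su; first exact: homogeneous_nat.
by rewrite NegzE mulrNz ncseriesN_apply -pmulrn homogeneous_nat // oppr0.
Qed.

Lemma homogeneous_var (I : eqType) (R : nzRingType) (i : I) :
  homogeneous 1 (ncvar R i).
Proof. by move=> u su; rewrite /ncvar; case: (u =P [:: i]) su => // ->. Qed.

Lemma homogeneous_word_eval (I : Type) N (X Z : 'M[ncseries I rat]_N) w :
  (forall a b, homogeneous 1 (X a b)) -> (forall a b, homogeneous 0 (Z a b)) ->
  forall a b, homogeneous (count_mem true w) (word_eval X Z w a b).
Proof.
move=> Xh Zh; rewrite /word_eval; elim: w => [|c w IH] a b.
  by rewrite big_nil mxE; apply: homogeneous_nat.
rewrite big_cons mxE; apply: homogeneous_sum => j.
by apply: homogeneousM; case: c => //=.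
Qed.

(** A word whose x-degree is not the size of u contributes nothing at u, so that
the sum over all words may be restricted to a set which is finite by
admissibility and does not depend on X, Z or the entry. *)
Lemma tr_series_eval (I : Type) N (f : ncseries bool rat)
    (X Z : 'M[ncseries I rat]_N) u :
  admissible f ->
  (forall a b, homogeneous 1 (X a b)) -> (forall a b, homogeneous 0 (Z a b)) ->
  \tr (series_eval f X Z) u =
  \sum_(w \in [set w : seq bool | count_mem true w = size u /\ f w != 0]%classic)
    f w * \tr (word_eval X Z w) u.
Proof.
move=> fadm Xh Zh; rewrite /mxtrace ncseries_sum_apply.
set S := [set w | _]%classic; have Sfin : finite_set S by exact: fadm.
have entry a : series_eval f X Z a a u =
    \sum_(w \in S) f w * word_eval X Z w a a u.
  rewrite mxE; apply/esym; apply: fsbig_widen => // w [_ /= wS].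
  have [->|fw] := eqVneq (f w) 0; first by rewrite mul0r.
  rewrite (homogeneous_word_eval Xh Zh) ?mulr0 //.
  by apply/eqP => su; apply: wS.
rewrite (eq_bigr _ (fun a _ => entry a)).
rewrite (eq_bigr _ (fun a _ => fsbig_finite _ _ Sfin)) fsbig_finite //=.
rewrite exchange_big /=; apply: eq_bigr => w _.
by rewrite ncseries_sum_apply mulr_sumr.
Qed.

(** The invariant attached to the monomial w in place of the series f. *)
Definition word_chi n (A : seifert n) (w : seq bool) : ncseries 'I_n rat :=
  \tr (word_eval (X_mx A) (map_mx intr (seifert_Z A)) w)
  - \tr (word_eval (X_mx A) (map_mx intr (I_half A)) w).

Lemma mxdiag_entry (V : nmodType) n (p : 'I_n -> nat)
    (B : forall i, 'M[V]_(p i)) (S : V -> Prop) :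
  S 0 -> (forall i a b, S (B i a b)) -> forall k l, S ((\mxdiag_i B i) k l).
Proof.
move=> S0 SB k l; rewrite mxE; move: (tagnat.sig2 k) (tagnat.sig2 l).
move: (tagnat.sig1 k) (tagnat.sig1 l) => i j a b.
have [ij|ij] := eqVneq i j; last by rewrite mxE.
by case: _ / ij in b *; rewrite conform_mx_id.
Qed.

Lemma chi_word_chi n (f : ncseries bool rat) (A : seifert n) u :
  admissible f ->
  chi f A u =
  \sum_(w \in [set w : seq bool | count_mem true w = size u /\ f w != 0]%classic)
    f w * word_chi A w u.
Proof.
move=> fadm; have Xh a b : homogeneous 1 (X_mx A a b).
  apply: mxdiag_entry => // i c d; rewrite mxE.
  by case: (c == d) => //; apply: homogeneous_var.
have Zh M a b : homogeneous 0 (map_mx (intr : int -> ncseries 'I_n rat) M a b).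
  by move=> ? ?; rewrite mxE; apply: homogeneous_int.
rewrite /chi raddfB /= ncseriesD_apply ncseriesN_apply.
rewrite !tr_series_eval //; try exact: Zh.
rewrite !fsbig_finite //= -sumrB; apply: eq_bigr => w _.
by rewrite -mulrBr.
Qed.

(** * Congruence by a block diagonal unimodular matrix *)

(** The hypothesis that P commutes with X makes X its own conjugate, so every
factor of the word is conjugated and the inner factors Q P cancel. *)
Lemma word_eval_conj (I : Type) N (X Z P Q : 'M[ncseries I rat]_N) w :
  Q *m P = 1%:M -> P *m Q = 1%:M -> P *m X = X *m P ->
  word_eval X (P *m Z *m Q) w = P *m word_eval X Z w *m Q.
Proof.
move=> QP PQ PX; have XE : X = P *m X *m Q by rewrite PX -mulmxA PQ mulmx1.
rewrite /word_eval; elim: w => [|c w IH]; first by rewrite !big_nil mulmx1.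
rewrite !big_cons IH; transitivity (P *m (if c then X else Z) *m Q *m
  (P *m \prod_(b <- w) (if b then X else Z) *m Q)).
  by case: c; rewrite -?XE.
by rewrite -!mulmxA [Q *m (P *m _)]mulmxA QP mul1mx.
Qed.

(** Cyclicity of the trace fails over a noncommutative ring; it survives when the
entries of one factor are integers, which are central. *)
Lemma mxtrace_intmxC (R : nzRingType) m N (P : 'M[int]_(m, N)) (M : 'M[R]_(N, m)) :
  \tr (map_mx intr P *m M) = \tr (M *m map_mx intr P).
Proof.
rewrite /mxtrace; under eq_bigr do rewrite mxE.
rewrite exchange_big /=; apply: eq_bigr => i _; rewrite mxE.
by apply: eq_bigr => j _; rewrite mxE commr_int.
Qed.

Lemma mul_mxdiag (R : pzSemiRingType) n (p : 'I_n -> nat)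
    (B C : forall i, 'M[R]_(p i)) :
  \mxdiag_i B i *m \mxdiag_i C i = \mxdiag_i (B i *m C i).
Proof.
rewrite [X in _ *m X]/mxdiag mul_mxdiag_mxblock; apply/eq_mxblock => i j.
case: eqVneq => [ij|_]; last by rewrite mulmx0.
by case: _ / ij; rewrite !conform_mx_id.
Qed.

Lemma map_mxdiag (aT rT : nmodType) (g : {additive aT -> rT}) n (p : 'I_n -> nat)
    (B : forall i, 'M[aT]_(p i)) :
  map_mx g (\mxdiag_i B i) = \mxdiag_i map_mx g (B i).
Proof.
apply/matrixP => k l; rewrite !mxE; case: eqVneq => [ij|_]; last first.
  by rewrite !mxE raddf0.
move: (tagnat.sig2 k) (tagnat.sig2 l) => a b; case: _ / ij in b *.
by rewrite !conform_mx_id mxE.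
Qed.

(** The off-diagonal blocks cancel because A_ij^T = A_ji. *)
Lemma seifert_skewE n (p : 'I_n -> nat) (A : 'M[int]_(\sum_i p i)) :
  is_seifert A ->
  A - A^T = \mxdiag_i (submxblock A i i - (submxblock A i i)^T).
Proof.
move=> [Asym _]; rewrite -[LHS]submxblockK; apply/eq_mxblock => i j.
rewrite submxblockB -tr_submxblock.
case: eqVneq => [ij|ij]; last by rewrite -Asym ?subrr // eq_sym.
by case: _ / ij; rewrite conform_mx_id.
Qed.

Lemma seifert_skew_unit n (p : 'I_n -> nat) (A : 'M[int]_(\sum_i p i)) :
  is_seifert A -> A - A^T \in unitmx.
Proof.
move=> hA; rewrite seifert_skewE //; case: hA => _ Adet.
set D := fun i => _ - _; apply: (proj1 (@mulmx1_unit _ _ _ (\mxdiag_i invmx (D i)) _)).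
rewrite mul_mxdiag -[1%:M]mxdiagZ; apply: eq_mxdiag => i.
by rewrite mulmxV // unitmxE Adet unitr1.
Qed.

(** As A - A^T is invertible, this equation characterizes Z_A; the effect of both
moves on Z_A is read off from it. *)
Lemma seifert_Z_skew n (A : seifert n) :
  seifert_Z A *m (sei_mx A - (sei_mx A)^T) = sei_mx A.
Proof. by rewrite /seifert_Z mulmxKV // seifert_skew_unit //; case: A. Qed.

(** With A replaced by D A D^T, the equation that characterizes Z_A is solved by
D Z_A D^-1, and D commutes with X because each diagonal block of X is a
multiple of the identity. *)
Lemma word_chi_move1 n p A (hA : is_seifert A) (P : forall i : 'I_n, 'M[int]_(p i))
    (hP : forall i, P i \in unitmx) :
  word_chi (Seifert p (move1_mx A P) (move1_seifert hA hP)) =1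
  word_chi (Seifert p A hA).
Proof.
move=> w; rewrite /word_chi; congr (_ - _).
set B := Seifert p _ _; set S := Seifert p A hA.
pose D := \mxdiag_i P i; pose E := \mxdiag_i invmx (P i).
have DE : D *m E = 1%:M.
  rewrite mul_mxdiag -[1%:M]mxdiagZ; apply: eq_mxdiag => i.
  by rewrite mulmxV.
have ED : E *m D = 1%:M by apply: mulmx1C.
have ZE : seifert_Z B = D *m seifert_Z S *m E.
  apply: (can_inj (mulmxK (seifert_skew_unit (seiP B)))).
  rewrite seifert_Z_skew /= /move1_mx !trmx_mul trmxK mulmxA -mulmxBl -mulmxBr.
  have ZD : seifert_Z S *m (A - A^T) = A := seifert_Z_skew S.
  rewrite -/D; rewrite -[X in D *m X *m D^T = _]ZD -!mulmxA.
  by rewrite [E *m _]mulmxA ED mul1mx.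
(* The integer matrices are moved to the coefficient ring, where conjugation by
   the image of D acts on words. *)
pose toL := map_mx (intr : int -> ncseries 'I_n rat).
have DX : toL _ _ D *m X_mx S = X_mx S *m toL _ _ D.
  rewrite /toL /D map_mxdiag /X_mx !mul_mxdiag; apply: eq_mxdiag => i.
  apply/matrixP => a b; rewrite mul_scalar_mx !mxE (bigD1 b) //= !mxE eqxx.
  rewrite big1 ?addr0 ?commr_int // => c cb.
  by rewrite !mxE (negPf cb) mulr0.
have toLE : toL _ _ E *m toL _ _ D = 1%:M by rewrite -map_mxM ED map_mx1.
have toLD : toL _ _ D *m toL _ _ E = 1%:M by rewrite -map_mxM DE map_mx1.
rewrite ZE !map_mxM -!/(toL _ _ _) (word_eval_conj _ _ toLE toLD DX).
rewrite -mulmxA mxtrace_intmxC.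
by rewrite -mulmxA toLE mulmx1.
Qed.

(** * Block triangular matrices with two extra diagonal entries *)

(** The indices of M' are those of M, embedded by [h \o inl], and two more,
[h (inr false)] and [h (inr true)]. In the order
[inr true], [inl _], [inr false] the matrix M' is block lower triangular, with
diagonal blocks [d true], [M] and [d false]. The new indices need not be
adjacent to each other or to the ends of the range, which is why the shape is
expressed through a bijection h instead of a block matrix. *)
Definition bordered (R : pzSemiRingType) N N' (h : 'I_N + bool -> 'I_N')
    (M' : 'M[R]_N') (M : 'M[R]_N) (d : bool -> R) : Prop :=
  [/\ forall k l, M' (h (inl k)) (h (inl l)) = M k l,
      forall s, M' (h (inr s)) (h (inr s)) = d s,
      forall k, M' (h (inl k)) (h (inr false)) = 0,
      forall k, M' (h (inr true)) (h (inl k)) = 0 &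
      M' (h (inr true)) (h (inr false)) = 0].

Lemma sum_bordered (V : nmodType) N N' (h : 'I_N + bool -> 'I_N') (F : 'I_N' -> V) :
  bijective h ->
  \sum_k F k = \sum_k F (h (inl k)) + (F (h (inr false)) + F (h (inr true))).
Proof.
move=> hb; rewrite (reindex h) /=; last exact: onW_bij.
by rewrite big_sumType /= big_bool [X in _ + X]addrC.
Qed.

(** Block lower triangular matrices are closed under products, and their diagonal
blocks multiply. *)
Lemma borderedM (R : pzSemiRingType) N N' (h : 'I_N + bool -> 'I_N')
    (M' L' : 'M[R]_N') (M L : 'M[R]_N) (d e : bool -> R) :
  bijective h -> bordered h M' M d -> bordered h L' L e ->
  bordered h (M' *m L') (M *m L) (fun s => d s * e s).
Proof.
move=> hb [Mc Md M1 M2 M3] [Lc Ld L1 L2 L3].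
split=> [k l|s|k|k|]; rewrite mxE (sum_bordered _ hb).
- rewrite M1 L2 mul0r mulr0 !addr0 mxE; apply: eq_bigr => m _.
  by rewrite Mc Lc.
- case: s.
    by rewrite M3 mul0r add0r Md Ld big1 ?add0r // => m _; rewrite M2 mul0r.
  by rewrite L3 mulr0 addr0 Md Ld big1 ?add0r // => m _; rewrite L1 mulr0.
- by rewrite M1 L3 mul0r mulr0 !addr0 big1 // => m _; rewrite L1 mulr0.
- by rewrite M3 L2 mul0r mulr0 !addr0 big1 // => m _; rewrite M2 mul0r.
- by rewrite M3 L3 mul0r mulr0 !addr0 big1 // => m _; rewrite L1 mulr0.
Qed.

Lemma bordered1 (R : pzSemiRingType) N N' (h : 'I_N + bool -> 'I_N') :
  injective h -> bordered h (1%:M : 'M[R]_N') 1%:M (fun=> 1).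
Proof. by move=> hi; split=> *; rewrite !mxE (inj_eq hi) ?eqxx. Qed.

Lemma mxtrace_bordered (R : pzSemiRingType) N N' (h : 'I_N + bool -> 'I_N')
    (M' : 'M[R]_N') (M : 'M[R]_N) (d : bool -> R) :
  bijective h -> bordered h M' M d -> \tr M' = \tr M + (d false + d true).
Proof.
move=> hb [Mc Md _ _ _]; rewrite /mxtrace (sum_bordered _ hb) !Md.
by congr (_ + _); apply: eq_bigr => k _.
Qed.

Lemma bordered_map (aT rT : pzRingType) (g : {rmorphism aT -> rT}) N N'
    (h : 'I_N + bool -> 'I_N') (M' : 'M[aT]_N') (M : 'M[aT]_N) (d : bool -> aT) :
  bordered h M' M d -> bordered h (map_mx g M') (map_mx g M) (g \o d).
Proof.
move=> [Mc Md M1 M2 M3].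
by split=> *; rewrite !mxE ?Mc ?Md ?M1 ?M2 ?M3 ?rmorph0.
Qed.

Lemma bordered_word_eval (I : Type) N N' (h : 'I_N + bool -> 'I_N')
    (X' Z' : 'M[ncseries I rat]_N') (X Z : 'M[ncseries I rat]_N) x z w :
  bijective h -> bordered h X' X (fun=> x) -> bordered h Z' Z z ->
  bordered h (word_eval X' Z' w) (word_eval X Z w)
    (fun s => \prod_(b <- w) (if b then x else z s)).
Proof.
move=> hb hX hZ; rewrite /word_eval; elim: w => [|c w IH].
  rewrite !big_nil; have := @bordered1 (ncseries I rat) _ _ _ (bij_inj hb).
  by case=> *; split=> // s; rewrite big_nil.
rewrite !big_cons; have hc : bordered h (if c then X' else Z')
  (if c then X else Z) (fun s => if c then x else z s) by case: c.
by case: (borderedM hb hc IH) => *; split=> // s; rewrite big_cons.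
Qed.

(** * Enlargement by two rows and columns *)

Lemma mxblock_Rank (V : Type) m n (p : 'I_m -> nat) (q : 'I_n -> nat)
    (B : forall i j, 'M[V]_(p i, q j)) i j (a : 'I_(p i)) (b : 'I_(q j)) :
  (\mxblock_(i, j) B i j) (tagnat.Rank i a) (tagnat.Rank j b) = B i j a b.
Proof. by have /matrixP/(_ a b) := mxblockK B i j; rewrite mxE. Qed.

Section Enlarge.
Variables (n : nat) (p : 'I_n -> nat) (i : 'I_n).

Definition old_index (k : 'I_(\sum_j p j)) : 'I_(\sum_j (p j + extra i j)) :=
  tagnat.Rank (tagnat.sig1 k) (lshift _ (tagnat.sig2 k)).

Lemma new_index_proof (s : bool) : (s < extra i i)%N.
Proof. by rewrite /extra eqxx; case: s. Qed.

Definition new_index (s : bool) : 'I_(\sum_j (p j + extra i j)) :=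
  tagnat.Rank i (rshift (p i) (Ordinal (new_index_proof s))).

(** The value true stands for the second of the two new rows, false for the
first. *)
Definition enlarged_index (ks : 'I_(\sum_j p j) + bool) :=
  match ks with inl k => old_index k | inr s => new_index s end.

Lemma enlarged_index_bij : bijective enlarged_index.
Proof.
apply: inj_card_bij; last first.
  rewrite card_ord card_sum card_ord card_bool big_split /= leq_add2l.
  by rewrite (bigD1 i) //= big1 /extra ?eqxx // => j /negPf ->.
have new_old k s : old_index k = new_index s -> False.
  move/(congr1 val)/eqP; rewrite tagnat.eq_Rank => /andP[/eqP e /eqP /= E].
  by have := ltn_ord (tagnat.sig2 k); rewrite E e ltnNge leq_addr.
case=> [k|s] [l|t] //= => [|/new_old[]|/esym/new_old[]|] /(congr1 val)/eqP;
  rewrite tagnat.eq_Rank => /andP[/eqP e /eqP /= E].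
  congr inl; rewrite -(tagnat.sig2K k) -(tagnat.sig2K l); apply/val_inj/eqP.
  by rewrite /= tagnat.eq_Rank; apply/andP; split; apply/eqP.
by move/addnI: E; case: s t {e} => [] [].
Qed.

Variables (A : 'M[int]_(\sum_j p j)) (rho : 'cV[int]_(\sum_j p j)) (c : bool).

Lemma move2_old_old k l :
  move2_mx A rho c i (old_index k) (old_index l) = A k l.
Proof. by rewrite mxblock_Rank block_mxEul mxE !tagnat.sig2K. Qed.

Lemma move2_old_new k s :
  move2_mx A rho c i (old_index k) (new_index s) = if s then 0 else rho k 0.
Proof. by rewrite mxblock_Rank block_mxEur !mxE tagnat.sig2K; case: s. Qed.

Lemma move2_new_old k s :
  move2_mx A rho c i (new_index s) (old_index k) = if s then 0 else rho k 0.
Proof. by rewrite mxblock_Rank block_mxEdl !mxE tagnat.sig2K; case: s. Qed.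

Lemma move2_new_new s t :
  move2_mx A rho c i (new_index s) (new_index t) =
  (if c then s && ~~ t else ~~ s && t)%:R.
Proof.
by rewrite mxblock_Rank block_mxEdr !mxE; case: c; case: s; case: t.
Qed.

(** A block diagonal matrix with diagonal blocks is diagonal, and so has the
bordered shape whatever the order of the indices. *)
Lemma bordered_mxdiag (R : pzSemiRingType)
    (D' : forall j, 'M[R]_(p j + extra i j)) (D : forall j, 'M[R]_(p j)) d :
  (forall j a b, D' j (lshift _ a) (lshift _ b) = D j a b) ->
  (forall j, is_diag_mx (D' j)) ->
  (forall s, D' i (rshift _ (Ordinal (new_index_proof s)))
    (rshift _ (Ordinal (new_index_proof s))) = d s) ->
  bordered enlarged_index (\mxdiag_j D' j) (\mxdiag_j D j) d.
Proof.
move=> DD D'diag Dd; have offdiag k l : k != l -> (\mxdiag_j D' j) k l = 0.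
  move=> kl; apply/is_diag_mxP: k l kl; apply/is_diag_mxblockP.
  by split=> [j1 j2 /negPf ->|j]; rewrite ?eqxx ?conform_mx_id.
split=> [k l|s|k|k|].
- rewrite [LHS]mxblock_Rank [RHS]mxE.
  move: (tagnat.sig2 k) (tagnat.sig2 l) => a b.
  case: eqVneq => [e|_]; last by rewrite !mxE.
  by case: _ / e b => b; rewrite !conform_mx_id.
- by rewrite [LHS]mxblock_Rank eqxx conform_mx_id.
- by apply: offdiag; rewrite (bij_eq enlarged_index_bij).
- by apply: offdiag; rewrite (bij_eq enlarged_index_bij).
- by apply: offdiag; rewrite (bij_eq enlarged_index_bij).
Qed.

Hypothesis hA : is_seifert A.
Let S := Seifert p A hA.
Let S' := Seifert _ (move2_mx A rho c i) (move2_seifert rho c i hA).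

(** The columns of Z_A' (A' - A'^T) = A' determine Z_A'. An old column of the
equation involves the old columns of Z_A' only, multiplied by A - A^T. A new
column of the equation is, up to sign, the other new column of Z_A', since
the two new indices form a skew 2 x 2 block. So the column of Z_A' at one new
index is the column of A' at the other, up to sign. *)
Lemma bordered_seifert_Z :
  bordered enlarged_index (seifert_Z S') (seifert_Z S) (fun s => (s (+) ~~ c)%:R).
Proof.
have hb := enlarged_index_bij.
have ZE x y : \sum_z seifert_Z S' x z * (move2_mx A rho c i z y
    - move2_mx A rho c i y z) = move2_mx A rho c i x y.
  have /matrixP/(_ x y) := seifert_Z_skew S'; rewrite mxE => <-.
  by apply: eq_bigr => z _; rewrite !mxE.
pose Z' := seifert_Z S'; pose D := A - A^T.
have Zold x l : \sum_k Z' x (old_index k) * D k l =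
    move2_mx A rho c i x (old_index l).
  rewrite -ZE (sum_bordered _ hb) /= !move2_old_new !move2_new_old !subrr.
  rewrite !mulr0 !addr0.
  by apply: eq_bigr => k _; rewrite !move2_old_old !mxE.
have Znew x s : Z' x (new_index s) =
    move2_mx A rho c i x (new_index (~~ s)) * (-1) ^+ (s (+) c).
  rewrite -ZE (sum_bordered _ hb) /= [X in (X + _) * _]big1 => [|k _]; last first.
    by rewrite move2_old_new move2_new_old subrr mulr0.
  rewrite !move2_new_new add0r -/Z'.
  by case: s; case: c => /=; rewrite ?(subrr, subr0, sub0r, mulr0, add0r, addr0,
    mulrN1, opprK, expr0, mulr1).
split=> [k l|s|k|k|] /=.
- (* The restriction of Z_A' to the old indices solves the equation of Z_A. *)
  suff /matrixP/(_ k l) : \matrix_(k, l) Z' (old_index k) (old_index l) =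
      seifert_Z S by rewrite mxE.
  apply: (can_inj (mulmxK (seifert_skew_unit hA))).
  rewrite [RHS](seifert_Z_skew S) /=; apply/matrixP => a b.
  rewrite mxE -[RHS]move2_old_old -Zold.
  by apply: eq_bigr => m _; rewrite mxE.
- by rewrite -/Z' Znew move2_new_new; case: s; case: c; rewrite /= ?mulr1 ?mul0r.
- by rewrite -/Z' Znew move2_old_new mul0r.
- (* The last row of A' vanishes at the old indices, and A - A^T is invertible. *)
  suff /rowP/(_ k) : \row_k Z' (new_index true) (old_index k) = 0 by rewrite !mxE.
  apply: (can_inj (mulmxK (seifert_skew_unit hA))).
  rewrite mul0mx; apply/rowP => b; rewrite !mxE.
  transitivity (\sum_m Z' (new_index true) (old_index m) * D m b).
    by apply: eq_bigr => m _; rewrite mxE.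
  by rewrite Zold move2_new_old.
- by rewrite -/Z' Znew move2_new_new; case: c; rewrite /= mul0r.
Qed.

(** The entries of I_half alternate along block i, so the two new ones are 0 and 1;
the parity of p i only decides their order. *)
Lemma bordered_I_half :
  bordered enlarged_index (I_half S') (I_half S) (fun s => (s (+) odd (p i))%:R).
Proof.
apply: bordered_mxdiag => [j a b|j|s].
- by rewrite !mxE.
- exact: diag_mx_is_diag.
- by rewrite !mxE eqxx /= oddD addbC; case: s.
Qed.

Lemma bordered_X_mx :
  bordered enlarged_index (X_mx S') (X_mx S) (fun=> ncvar rat i).
Proof.
apply: bordered_mxdiag => [j a b|j|s].
- by rewrite !mxE.
- exact: scalar_mx_is_diag.
- by rewrite !mxE eqxx.
Qed.

(** The new diagonal entries of Z_A' are 0 and 1 in some order, and so are those of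
I_half. The two words in x_i and these entries have the same sum on both sides
and cancel. *)
Lemma word_chi_move2 : word_chi S' =1 word_chi S.
Proof.
move=> w; have hb := enlarged_index_bij.
have hX := bordered_X_mx.
have hZ := bordered_map (intr : {rmorphism int -> ncseries 'I_n rat}) bordered_seifert_Z.
have hI := bordered_map (intr : {rmorphism int -> ncseries 'I_n rat}) bordered_I_half.
rewrite /word_chi (mxtrace_bordered hb (bordered_word_eval w hb hX hZ)).
rewrite (mxtrace_bordered hb (bordered_word_eval w hb hX hI)) /=.
rewrite opprD addrACA [X in _ + X](_ : _ = 0) ?addr0 //.
apply/eqP; rewrite subr_eq0.
by case: c; case: (odd (p i)) => //=; rewrite addrC.
Qed.

End Enlarge.

Lemma word_chi_s12 n (A B : seifert n) w :
  s12_equiv A B -> word_chi A w = word_chi B w.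
Proof.
elim=> {A B} [_ _ []||C D _ ->|C D E _ -> _ ->] //.
- by move=> p M hM P hP; rewrite word_chi_move1.
- by move=> p M hM rho c i; rewrite word_chi_move2.
Qed.

Theorem theorem1 (n : nat) (hn : (1 <= n)%N) (f : ncseries bool rat)
    (hf : admissible f) (A B : seifert n) (hAB : s12_equiv A B) :
  chi f A = chi f B.
Proof.
apply/funext => u; rewrite !chi_word_chi //.
by apply: eq_fsbigr => w _; rewrite (word_chi_s12 _ hAB).
Qed.
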